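(* Let $\{R_k\}_{k\in N_T}$ be real symmetric positive definite $n\times n$ matrices and $\{A_k\}_{k\in N_{T-1}},\{C_k\}_{k\in N_{T-1}}$ real $n\times n$ matrices. For all integers $0\le k\le l\le T$, $$\psi_{l,k}'(I_{2^{l-k}}\otimes R_l)\psi_{l,k}=R_k^{\frac12}\bar\psi_{l,k}'\bar\psi_{l,k}R_k^{\frac12}.$$
   Context: $T\ge1$ is an integer, $N_T:=\{0,1,\dots,T\}$; $M'$ is the transpose, $\otimes$ the Kronecker product, $I_m$ the $m\times m$ identity, and $R^{1/2}$ the symmetric positive definite square root of $R$. Set $\bar A_k=R_{k+1}^{1/2}A_kR_k^{-1/2}$ and $\bar C_k=R_{k+1}^{1/2}C_kR_k^{-1/2}$ for $k\in N_{T-1}$. Define $\psi_{l,l}=\bar\psi_{l,l}=I_n$ and, for $l>k$, $$\psi_{l,k}=\begin{bmatrix}\psi_{l,k+1}A_k\\ \psi_{l,k+1}C_k\end{bmatrix},\qquad \bar\psi_{l,k}=\begin{bmatrix}\bar\psi_{l,k+1}\bar A_k\\ \bar\psi_{l,k+1}\bar C_k\end{bmatrix}.$$ *)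

(* Defs.v *)
From HB Require Import structures.
From mathcomp Require Import all_boot all_order all_algebra.
From mathcomp Require Import boolp classical_sets reals.
From mathcomp Require Export mxtens.

Set Implicit Arguments.
Unset Strict Implicit.
Unset Printing Implicit Defensive.

Import Order.TTheory GRing.Theory Num.Theory.
Local Open Scope ring_scope.

Definition sym_posdef (R : realType) (n : nat) (M : 'M[R]_n) : Prop :=
  M^T = M /\ forall x : 'cV[R]_n, x != 0 -> 0 < (x^T *m M *m x) 0 0.

(* The symmetric positive definite square root of M. For symmetric positive
   definite M exactly one matrix satisfies the description; if no matrix does,
   the value is the dummy 0. *)
Definition sqrtmx (R : realType) (n : nat) (M : 'M[R]_n) : 'M[R]_n :=
  xget 0 [set S : 'M[R]_n | sym_posdef S /\ S *m S = M]%classic.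

(* R_k^{-1/2} is the inverse of R_k^{1/2}. *)
Definition bar (R : realType) (n : nat) (Rm M : nat -> 'M[R]_n) (k : nat) :
    'M[R]_n :=
  sqrtmx (Rm k.+1) *m M k *m invmx (sqrtmx (Rm k)).

Lemma psi_rows0 (n : nat) : n = (2 ^ 0 * n)%N.
Proof. by rewrite expn0 mul1n. Qed.

Lemma psi_rowsS (n d : nat) : (2 ^ d * n + 2 ^ d * n)%N = (2 ^ d.+1 * n)%N.
Proof. by rewrite expnS mul2n -addnn mulnDl. Qed.

(* psi_rec A C d k is psi_{k+d,k}: the recursion is on the gap d = l - k, on
   which the number of rows depends; the casts only rewrite that number. *)
Fixpoint psi_rec (R : pzRingType) (n : nat) (A C : nat -> 'M[R]_n) (d k : nat)
    : 'M[R]_((2 ^ d * n)%N, n) :=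
  match d with
  | 0 => castmx (psi_rows0 n, erefl n) 1%:M
  | d'.+1 => castmx (psi_rowsS n d', erefl n)
      (col_mx (psi_rec A C d' k.+1 *m A k) (psi_rec A C d' k.+1 *m C k))
  end.

(* Only meaningful for k <= l. *)
Definition psi (R : pzRingType) (n : nat) (A C : nat -> 'M[R]_n) (l k : nat)
    : 'M[R]_((2 ^ (l - k) * n)%N, n) :=
  psi_rec A C (l - k) k.

(* Main.v *)
Require Import Defs.
From HB Require Import structures.
From mathcomp Require Import all_boot all_order all_algebra.
From mathcomp Require Import boolp classical_sets reals.
From mathcomp Require Import complex spectral.

Set Implicit Arguments.
Unset Strict Implicit.
Unset Printing Implicit Defensive.

Import Order.TTheory GRing.Theory Num.Theory.
Local Open Scope ring_scope.

(** The matrix on the left-hand side is the Gram matrix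
      G_(l,k) = psi_(l,k)' (I (x) R_l) psi_(l,k).
    Since psi_(l,k) stacks psi_(l,k+1) A_k on top of psi_(l,k+1) C_k, and the
    weight I (x) R_l is block diagonal, G satisfies the backward recursion
      G_(l,l) = R_l,   G_(l,k) = A_k' G_(l,k+1) A_k + C_k' G_(l,k+1) C_k
    ([psi_gram0], [psi_gramS]). The right-hand side is built from the same
    recursion for the barred matrices, started from I because I (x) I = I.
    Since bar A_k R_k^(1/2) = R_(k+1)^(1/2) A_k, and likewise for C, conjugating
    the barred recursion by R_k^(1/2) turns it into the unbarred one, so the
    two sides agree by induction on l - k ([psi_gram_bar]).

    This uses of R_k^(1/2) only that it is symmetric, invertible and squares to
    R_k. As [sqrtmx] is obtained by choice, these properties have to be earned
    by proving that a square root exists ([sqrtmx_exists]). The spectral theorem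
    over the complex numbers shows that a real polynomial vanishing on the
    spectrum of a real symmetric matrix M annihilates M ([sym_spectrum]). If M
    is positive definite its eigenvalues are positive, so that interpolation
    gives a real polynomial q with q(d) = d^(1/4) at every eigenvalue d. Then
    q(M)^4 = M, and S = q(M)^2 is the desired root: q(M) is symmetric and
    invertible, which makes its square positive definite. *)

(** * Existence of the positive definite square root *)

Lemma poly_interpolation (F : fieldType) (f : F -> F) (s : seq F) :
  exists q : {poly F}, {in s, forall x, q.[x] = f x}.
Proof.
elim: s => [|x s [q qf]]; first by exists 0.
have [xs|xNs] := boolP (x \in s).
  by exists q => y; rewrite inE => /predU1P[->|]; exact: qf.
pose w : {poly F} := \prod_(y <- s) ('X - y%:P).
have wx : w.[x] != 0 by rewrite -[_ == 0]/(root w x) root_prod_XsubC.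
exists (q + ((f x - q.[x]) / w.[x])%:P * w) => y.
rewrite inE !hornerE => /predU1P[->|ys]; first by rewrite divfK// subrKC.
have /rootP-> : root w y by rewrite root_prod_XsubC.
by rewrite mulr0 addr0 qf.
Qed.

Lemma trmx_horner_mx (R : comNzRingType) (n : nat) (M : 'M[R]_n.+1)
    (p : {poly R}) :
  (horner_mx M p)^T = horner_mx M^T p.
Proof.
elim/poly_ind: p => [|p c IHp]; first by rewrite !rmorph0 trmx0.
rewrite !(rmorphD, rmorphM)/= !(horner_mx_X, horner_mx_C).
rewrite linearD/= tr_scalar_mx trmx_mul IHp; congr (_ + _).
exact: comm_mx_horner.
Qed.

(** Over R[i] the matrix M is unitarily similar to a diagonal matrix with real
    entries, which are eigenvalues of M itself as R[i] extends R; evaluating p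
    at M evaluates p at these entries. Working with annihilating polynomials
    lets the diagonalization stay complex while the conclusion is real. *)
Lemma sym_spectrum (R : rcfType) (n : nat) (M : 'M[R]_n.+1) :
  M^T = M ->
  exists2 s : seq R, {in s, forall d, eigenvalue M d} &
    forall p : {poly R}, {in s, forall d, p.[d] = 0} -> horner_mx M p = 0.
Proof.
move=> Msym; pose toC := real_complex R; pose A := map_mx toC M.
have Aherm : A \is hermsymmx.
  apply: realsym_hermsym.
    apply/is_hermitianmxP.
    by rewrite expr0 scale1r map_mx_id// /A map_trmx Msym.
  by apply/mxOverP => i j; rewrite !mxE; apply/complex_realP; exists (M i j).
have /orthomx_spectralP := hermitian_normalmx Aherm.
set P := spectralmx A; set D := spectral_diag A => AE.
have Punit : P \in unitmx by exact: spectral_unit.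
pose d i : R := complex.Re (D 0 i).
have dE i : D 0 i = toC (d i).
  by rewrite /toC RRe_real//; exact/mxOverP/hermitian_spectral_diag_real.
exists [seq d i | i : 'I_n.+1].
  move=> _ /mapP[i _ ->].
  suff: eigenvalue A (D 0 i) by rewrite dE eigenvalue_map.
  apply/eigenvalueP; exists (row i P).
    have PA : P *m A = diag_mx D *m P.
      by rewrite [in LHS]AE !mulmxA mulmxV// mul1mx.
    rewrite -row_mul PA.
    by apply/rowP => j; rewrite mul_diag_mx !mxE.
  have : row i P *m invmx P = delta_mx 0 i by rewrite rowE mulmxK.
  apply: contra_eq_neq => ->; rewrite mul0mx eq_sym.
  by apply/eqP => /rowP/(_ i)/eqP; rewrite !mxE !eqxx oner_eq0.
move=> p p0; apply: (@map_mx_inj _ _ toC); rewrite map_mx0 map_horner_mx.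
rewrite -/A AE horner_mx_uconjC// horner_mx_diag.
have -> : map_mx (horner (map_poly toC p)) D = 0.
  apply/rowP => i; rewrite !mxE dE horner_map p0 ?rmorph0//.
  by apply/mapP; exists i; rewrite ?mem_enum.
by rewrite linear0 mulmx0 mul0mx.
Qed.

Lemma dotmx_gt0 (R : realDomainType) (n : nat) (x : 'cV[R]_n) :
  x != 0 -> 0 < (x^T *m x) 0 0.
Proof.
move=> x0; rewrite mxE; under eq_bigr do rewrite mxE -expr2.
rewrite lt0r sumr_ge0 ?andbT => [|i _]; last exact: sqr_ge0.
apply: contra x0; rewrite psumr_eq0 => [|i _]; last exact: sqr_ge0.
move=> /allP x0; apply/eqP/colP => i; rewrite mxE.
by apply/eqP; rewrite -sqrf_eq0; exact: x0 (mem_index_enum i).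
Qed.

Lemma eigenvalue_posdef_gt0 (R : realType) (n : nat) (M : 'M[R]_n) (d : R) :
  sym_posdef M -> eigenvalue M d -> 0 < d.
Proof.
move=> [_ Mpos] /eigenvalueP[v vM v0].
have vT0 : v^T != 0 by rewrite trmx_eq0.
have := Mpos _ vT0; rewrite trmxK vM -scalemxAl mxE pmulr_lgt0//.
by have := dotmx_gt0 vT0; rewrite trmxK.
Qed.

Lemma sym_posdef_sqr (R : realType) (n : nat) (Q : 'M[R]_n) :
  Q^T = Q -> Q \in unitmx -> sym_posdef (Q *m Q).
Proof.
move=> Qsym Qunit; split=> [|x x0]; first by rewrite trmx_mul Qsym.
rewrite -{1}Qsym mulmxA -trmx_mul -mulmxA; apply: dotmx_gt0.
by apply: contra_neq x0 => Qx0; rewrite -[x](mulKmx Qunit) Qx0 mulmx0.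
Qed.

Lemma unitmx_sym_posdef (R : realType) (n : nat) (M : 'M[R]_n) :
  sym_posdef M -> M \in unitmx.
Proof.
move=> [Msym Mpos]; rewrite -row_free_unit -kermx_eq0; apply/negPn/negP.
move=> /rowV0Pn[v /sub_kermxP vM v0].
have vT0 : v^T != 0 by rewrite trmx_eq0.
by have := Mpos _ vT0; rewrite trmxK vM mul0mx mxE ltxx.
Qed.

(** Interpolating the fourth root rather than the square root makes positivity
    of the result immediate: it is the square of an invertible symmetric
    matrix. *)
Lemma sqrtmx_exists (R : realType) (n : nat) (M : 'M[R]_n) :
  sym_posdef M -> exists S : 'M[R]_n, sym_posdef S /\ S *m S = M.
Proof.
case: n M => [|n] M Mspd.
  (* Matrices of size 0 have no ring structure, hence no [horner_mx]. *)
  by exists M; split=> //; rewrite [LHS]flatmx0 [RHS]flatmx0.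
have [s s_eig s_annih] := sym_spectrum Mspd.1.
have [q qE] := poly_interpolation (fun d => Num.sqrt (Num.sqrt d)) s.
pose Q := horner_mx M q.
have QM : (Q *m Q) *m (Q *m Q) = M.
  have -> : (Q *m Q) *m (Q *m Q) = horner_mx M (q ^+ 4).
    by rewrite rmorphXn/= !exprS expr0 mulr1 /Q !mulmxE !mulrA.
  apply/eqP; rewrite -subr_eq0 -[X in _ - X](horner_mx_X M) -rmorphB/=.
  apply/eqP/s_annih => d ds; rewrite !hornerE qE// (exprM _ 2 2).
  have /ltW d0 := eigenvalue_posdef_gt0 Mspd (s_eig d ds).
  by rewrite !sqr_sqrtr ?sqrtr_ge0// subrr.
exists (Q *m Q); split=> //; apply: sym_posdef_sqr.
  by rewrite /Q trmx_horner_mx Mspd.1.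
have := unitmx_sym_posdef Mspd; rewrite -{1}QM -mulmxA.
by rewrite unitmx_mul => /andP[].
Qed.

Lemma sqrtmxP (R : realType) (n : nat) (M : 'M[R]_n) :
  sym_posdef M -> sym_posdef (sqrtmx M) /\ sqrtmx M *m sqrtmx M = M.
Proof. by move=> /sqrtmx_exists/(xgetPex 0). Qed.

(** * Block structure of the weight I (x) Q *)

Lemma mxtens_index_lshift (m1 m2 n : nat) (i : 'I_m1) (j : 'I_n) :
  cast_ord (esym (mulnDl m1 m2 n)) (lshift (m2 * n) (mxtens_index (i, j))) =
  mxtens_index (lshift m2 i, j).
Proof. exact: val_inj. Qed.

Lemma mxtens_index_rshift (m1 m2 n : nat) (i : 'I_m2) (j : 'I_n) :
  cast_ord (esym (mulnDl m1 m2 n)) (rshift (m1 * n) (mxtens_index (i, j))) =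
  mxtens_index (rshift m1 i, j).
Proof. by apply: val_inj; rewrite /= mulnDl addnA. Qed.

Lemma tens_1mx_block (R : pzRingType) (m1 m2 n : nat) (Q : 'M[R]_n) :
  castmx (mulnDl m1 m2 n, mulnDl m1 m2 n) ((1%:M : 'M_(m1 + m2)) *t Q) =
  block_mx ((1%:M : 'M_m1) *t Q) 0 0 ((1%:M : 'M_m2) *t Q).
Proof.
apply/matrixP => i j; rewrite castmxE -(splitK i) -(splitK j).
case: (split i) (split j) => [i0|i0] [j0|j0] /=;
  case: (mxtens_indexP i0) => i1 i2; case: (mxtens_indexP j0) => j1 j2;
  rewrite !(mxtens_index_lshift, mxtens_index_rshift) tensmxE
    ?(block_mxEul, block_mxEur, block_mxEdl, block_mxEdr) ?tensmxE !mxE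
    ?(eq_lshift, eq_rshift, eq_lrshift, eq_rlshift) ?mul0r //.
Qed.

(** The row count of the stack is an arbitrary product m * n and the cast an
    arbitrary proof, so that the lemma applies to the casts inside [psi_rec],
    where m is a power of 2. *)
Lemma gram_col_mx (R : pzRingType) (m1 m2 m n p : nat) (Q : 'M[R]_n)
    (em : (m1 + m2)%N = m) (emn : (m1 * n + m2 * n)%N = (m * n)%N)
    (X : 'M[R]_((m1 * n)%N, p)) (Y : 'M[R]_((m2 * n)%N, p)) :
  let Z := castmx (emn, erefl p) (col_mx X Y) in
  Z^T *m ((1%:M : 'M_m) *t Q) *m Z =
  X^T *m ((1%:M : 'M_m1) *t Q) *m X + Y^T *m ((1%:M : 'M_m2) *t Q) *m Y.
Proof.
case: m / em emn => emn /=.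
have -> : (1%:M : 'M_(m1 + m2)) *t Q = castmx (emn, emn)
    (block_mx ((1%:M : 'M_m1) *t Q) 0 0 ((1%:M : 'M_m2) *t Q)).
  by rewrite -tens_1mx_block castmx_comp castmx_id.
case: _ / emn; rewrite !castmx_id tr_col_mx mul_row_block mul_row_col.
by rewrite !mulmx0 addr0 add0r.
Qed.

(** * The Gram recursion *)

Definition psi_gram (R : pzRingType) (n : nat) (A C : nat -> 'M[R]_n)
    (Q : 'M[R]_n) (d k : nat) : 'M[R]_n :=
  (psi_rec A C d k)^T *m ((1%:M : 'M_(2 ^ d)) *t Q) *m psi_rec A C d k.

Lemma psi_gram0 (R : pzRingType) (n : nat) (A C : nat -> 'M[R]_n)
    (Q : 'M[R]_n) (k : nat) :
  psi_gram A C Q 0 k = Q.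
Proof.
rewrite /psi_gram /= tens_scalar1mx.
have -> : esym (mul1n n) = psi_rows0 n by exact: eq_irrelevance.
by case: _ / (psi_rows0 n); rewrite !castmx_id trmx1 mul1mx mulmx1.
Qed.

Lemma psi_gramS (R : comPzRingType) (n : nat) (A C : nat -> 'M[R]_n)
    (Q : 'M[R]_n) (d k : nat) :
  psi_gram A C Q d.+1 k = (A k)^T *m psi_gram A C Q d k.+1 *m A k
                          + (C k)^T *m psi_gram A C Q d k.+1 *m C k.
Proof.
have e2 : (2 ^ d + 2 ^ d)%N = (2 ^ d.+1)%N by rewrite expnS mul2n addnn.
by rewrite /psi_gram /= (gram_col_mx _ e2) !trmx_mul !mulmxA.
Qed.

Lemma tens_1mx_1mx (R : pzRingType) (m n : nat) :
  (1%:M : 'M[R]_m) *t (1%:M : 'M[R]_n) = 1%:M.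
Proof.
apply/matrixP => i j.
case: (mxtens_indexP i) => i1 i2; case: (mxtens_indexP j) => j1 j2.
rewrite tensmxE !mxE (can_eq (@mxtens_indexK _ _)) xpair_eqE.
by rewrite -natrM mulnb.
Qed.

(** The square root is invertible, so conjugation by it cancels the inverse
    inside [bar]; the weight Rm (k + d) carries the terminal index, which stays
    fixed along the induction. *)
Lemma psi_gram_bar (R : realType) (n : nat) (Rm A C : nat -> 'M[R]_n)
    (d k : nat) :
  (forall j, (k <= j <= k + d)%N -> sym_posdef (Rm j)) ->
  psi_gram A C (Rm (k + d)%N) d k =
  sqrtmx (Rm k) *m psi_gram (bar Rm A) (bar Rm C) 1%:M d k *m sqrtmx (Rm k).
Proof.
elim: d k => [|d IHd] k hR; have [Sk_spd SkSk] : sym_posdef (sqrtmx (Rm k)) /\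
    sqrtmx (Rm k) *m sqrtmx (Rm k) = Rm k
  by apply: sqrtmxP; apply: hR; rewrite leqnn leq_addr.
  by rewrite !psi_gram0 addn0 mulmx1 SkSk.
have barK M : bar Rm M k *m sqrtmx (Rm k) = sqrtmx (Rm k.+1) *m M k.
  by rewrite mulmxKV// unitmx_sym_posdef// Sk_spd.
have sqrt_tr j : (k <= j <= k + d.+1)%N -> (sqrtmx (Rm j))^T = sqrtmx (Rm j).
  by move=> /hR/sqrtmxP[[]].
have barKT M : sqrtmx (Rm k) *m (bar Rm M k)^T = (M k)^T *m sqrtmx (Rm k.+1).
  rewrite -[in LHS](sqrt_tr k) ?leqnn ?leq_addr// -trmx_mul barK trmx_mul.
  by rewrite sqrt_tr // leqnSn addnS ltnS leq_addr.
rewrite !psi_gramS -addSnnS IHd; last first.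
  by move=> j /andP[kj jkd]; apply: hR; rewrite (ltnW kj) -addSnnS.
move: (psi_gram _ _ 1%:M d k.+1) (bar Rm A k) (bar Rm C k)
  (barK A) (barK C) (barKT A) (barKT C) => G bA bC KA KC KTA KTC.
by rewrite mulmxDr mulmxDl !mulmxA KTA KTC -!mulmxA KA KC.
Qed.

Theorem lemma7 (R : realType) (n T : nat) (hT : (1 <= T)%N)
    (Rm A C : nat -> 'M[R]_n)
    (hR : forall k : nat, (k <= T)%N -> sym_posdef (Rm k))
    (k l : nat) (hkl : (k <= l)%N) (hlT : (l <= T)%N) :
  (psi A C l k)^T *m ((1%:M : 'M[R]_(2 ^ (l - k))%N) *t Rm l) *m psi A C l k
  = sqrtmx (Rm k) *m (psi (bar Rm A) (bar Rm C) l k)^T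
      *m psi (bar Rm A) (bar Rm C) l k *m sqrtmx (Rm k).
Proof.
have := @psi_gram_bar _ _ Rm A C (l - k) k.
rewrite subnKC// /psi_gram tens_1mx_1mx mulmx1 -/(psi A C l k) => ->.
  by rewrite !mulmxA.
by move=> j /andP[_ jl]; exact/hR/(leq_trans jl).
Qed.
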